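(* Let $2\le p\le\infty$, $n\ge2$, $0<\epsilon<1$, $0<\delta\le1/e$, and let $A$ be any distribution on $\{1,\dots,n\}$. Draw $m=\frac{4\ln(1/\delta)}{\epsilon^2}$ i.i.d. samples from $A$ and let $\hat A_i=X_i/m$, where $X_i$ is the number of samples equal to $i$. Then $\|\hat A-A\|_p\le\epsilon$ with probability at least $1-\delta$.
   Context: A distribution on $\{1,\dots,n\}$ is a vector $A\in\mathbb{R}^n$, $A_i\ge0$, $\sum_iA_i=1$; $\|V\|_p=(\sum_i|V_i|^p)^{1/p}$, $\|V\|_\infty=\max_i|V_i|$. *)

(* Defs.v *)
From mathcomp Require Import all_boot all_order all_algebra.
From mathcomp Require Import all_classical all_reals all_analysis.

Set Implicit Arguments.
Unset Strict Implicit.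
Unset Printing Implicit Defensive.

Import Order.TTheory GRing.Theory Num.Theory.

Local Open Scope classical_set_scope.
Local Open Scope ring_scope.

Definition is_distribution (R : realType) (n : nat) (A : 'rV[R]_n) : Prop :=
  (forall i, 0 <= A 0 i) /\ \sum_i A 0 i = 1.

(* The exponent is an extended real so that p = +oo is included; the value at
   -oo is a placeholder. *)
Definition lpnorm (R : realType) (n : nat) (p : \bar R) (V : 'rV[R]_n) : R :=
  match p with
  | r%:E => (\sum_i `|V 0 i| `^ r) `^ r^-1
  | +oo%E => \big[Num.max/0]_i `|V 0 i|
  | -oo%E => 0
  end.

(* S carries the discrete sigma-algebra: the B j are arbitrary sets. *)
Definition mutually_independent (d : measure_display) (T : measurableType d)
    (R : realType) (P : probability T R) (I : finType) (S : Type)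
    (X : I -> T -> S) : Prop :=
  forall (J : {set I}) (B : I -> set S),
    P (\bigcap_(j in [set` J]) X j @^-1` B j) =
    (\prod_(j in J) P (X j @^-1` B j))%E.

Definition iid_samples (d : measure_display) (T : measurableType d)
    (R : realType) (P : probability T R) (m n : nat) (A : 'rV[R]_n)
    (X : 'I_m -> T -> 'I_n) : Prop :=
  [/\ forall j (B : set 'I_n), measurable (X j @^-1` B),
      forall j i, P (X j @^-1` [set i]) = (A 0 i)%:E
    & mutually_independent P X].

Definition empirical (R : realType) (m n : nat) (s : 'I_m -> 'I_n) :
    'rV[R]_n :=
  \row_i (#|[set j | s j == i]%SET|%:R / m%:R).

(* Main.v *)
Require Import Defs.
From mathcomp Require Import all_boot all_order all_algebra.
From mathcomp Require Import all_classical all_reals all_analysis.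
From mathcomp Require Import ring lra.

Set Implicit Arguments.
Unset Strict Implicit.
Unset Printing Implicit Defensive.

Import Order.TTheory GRing.Theory Num.Theory.
Import numFieldNormedType.Exports.

Local Open Scope classical_set_scope.
Local Open Scope ring_scope.

(** For p >= 2 the p-norm is at most the Euclidean norm, so it is enough to
    bound the Euclidean norm of the deviation of the counts,
    D = sum_j (e_(X_j) - A), by m * eps.  Its second moment is at most m, so
    its mean is at most sqrt m.  Replacing one sample changes |D| by at most
    sqrt 2, and McDiarmid's inequality gives
    P(|D| > sqrt m + t) <= exp (- t^2 / m).  For t = m * eps - sqrt m the
    exponent is (sqrt m * eps - 1)^2 >= (2 sqrt L - 1)^2 >= L where
    L = ln (1 / delta) >= 1.  There is no slack at L = 1, so Hoeffding's lemma
    is needed with its sharp constant 1/8. *)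

(** * Hoeffding's lemma for finitely supported laws *)

Lemma ge0_is_derive_le (R : realType) (f df : R -> R) (a b : R) :
  (forall x : R, is_derive x 1 f (df x)) -> (forall x, a <= x -> 0 <= df x) ->
  a <= b -> f a <= f b.
Proof.
move=> fdf df0 ab.
have [|c /itvP c_ab] := MVT_segment ab (fun x _ => fdf x).
  apply/continuous_subspaceT => x.
  by apply/differentiable_continuous/derivable1_diffP; case: (fdf x).
by rewrite -subr_ge0 => ->; rewrite mulr_ge0 ?subr_ge0// df0// c_ab.
Qed.

(** The left side is the moment generating function of a Bernoulli law of mean [t]. The exponent
    minus its logarithm vanishes at 0 together with its derivative. Its second derivative is 1/4
    minus the variance q (1 - q) of the tilted law, q = t e^x / D(x), hence (1/2 - q)^2. *)
Lemma hoeffding_bernoulli (R : realType) (t u : R) : 0 <= t <= 1 -> 0 <= u ->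
  1 - t + t * expR u <= expR (t * u + u ^+ 2 / 8).
Proof.
move=> /andP[t0 t1] u0.
pose D (x : R) : R := 1 - t + t * expR x.
have D0 x : 0 < D x.
  have := expR_gt0 x; rewrite /D; nra.
(* [g1] is the derivative of [g], and that of [g1] is a square. *)
pose g1 (x : R) := x / 4 + t - t * expR x * (D x)^-1.
pose g (x : R) := x ^+ 2 / 8 + t * x - ln (D x).
have dD (x : R) : is_derive x 1 D (t * expR x).
  by rewrite /D; apply: is_derive_eq; rewrite add0r mul1r.
have dV (x : R) :
    is_derive x 1 (fun y => (D y)^-1) (- (D x) ^- 2 *: (t * expR x)).
  by apply: is_deriveV; rewrite gt_eqF.
have dL (x : R) :
    is_derive x 1 (fun y => ln (D y)) ((D x)^-1 * (t * expR x)).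
  exact: (is_derive1_comp (is_derive1_ln (D0 x)) (dD x)).
have dg1 (x : R) : is_derive x 1 g1 ((1 / 2 - t * expR x / D x) ^+ 2).
  rewrite /g1; apply: is_derive_eq.
  rewrite /GRing.scale /=; move: (expR x) (D x) (D0 x) => e y y0.
  by field; rewrite gt_eqF.
have dg (x : R) : is_derive x 1 g (g1 x).
  rewrite /g; apply: is_derive_eq.
  rewrite /g1 /GRing.scale /=; move: (expR x) (D x) (D0 x) => e y y0.
  by field; rewrite gt_eqF.
have g1_ge0 x : 0 <= x -> 0 <= g1 x.
  move=> x0; have := ge0_is_derive_le dg1 (fun y _ => sqr_ge0 _) x0.
  apply: le_trans.
  by rewrite /g1 /D expR0 mulr1 subrK mul0r add0r invr1 mulr1 subrr.
have := ge0_is_derive_le dg g1_ge0 u0.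
rewrite /g {1}/D expR0 mulr1 subrK ln1 mulr0 expr0n mul0r addr0 subr0 subr_ge0.
rewrite -ler_expR lnK ?posrE//.
by rewrite addrC.
Qed.

(** Convexity of exp. The points - q c and c - q c have mean 0 under the weights 1 - q and q, so
    averaging e^x >= 1 + x over them gives at least 1. *)
Lemma expR_chord (R : realType) (q a c : R) : 0 <= q <= 1 ->
  expR (a + q * c) <= expR a * (1 - q + q * expR c).
Proof.
move=> /andP[q0 q1]; rewrite expRD ler_pM2l ?expR_gt0//.
have h1 := expR_ge1Dx (- (q * c)); have h2 := expR_ge1Dx (c - q * c).
have -> : expR c = expR (q * c) * expR (c - q * c) by rewrite -expRD subrKC.
have -> : 1 - q = expR (q * c) * ((1 - q) * expR (- (q * c))).
  by rewrite mulrCA -expRD subrr expR0 mulr1.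
rewrite [q * (_ * _)]mulrCA -mulrDr ler_peMr ?expR_ge0//.
nra.
Qed.

(** All values lie in [a, a + c] with [a] the least one. Bounding exp there by its chord replaces
    [y] by a two-point variable on a and a + c with the same mean, which is the Bernoulli case. *)
Lemma hoeffding_lemma (R : realType) (I : finType) (w y : I -> R) (c : R) :
  (forall i, 0 <= w i) -> \sum_i w i = 1 -> 0 < c ->
  (forall i j, y i - y j <= c) ->
  \sum_i w i * expR (y i) <= expR (\sum_i w i * y i + c ^+ 2 / 8).
Proof.
move=> w0 w1 c0 osc.
have [i0 _|I0] := pickP (@predT I); last first.
  by have /eqP := w1; rewrite big_pred0// eq_sym oner_eq0.
pose a := y [arg min_(i < i0) y i]%O.
have ya i : a <= y i by rewrite /a; case: arg_minP => // j _; apply.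
pose q i := (y i - a) / c.
have q01 i : 0 <= q i <= 1.
  by rewrite /q ler_pdivrMr// mul1r osc andbT divr_ge0 ?subr_ge0// ltW.
have yE i : y i = a + q i * c by rewrite /q divfK ?gt_eqF// subrKC.
pose t := \sum_i w i * q i.
have t01 : 0 <= t <= 1.
  apply/andP; split.
    by apply: sumr_ge0 => i _; case/andP: (q01 i) => *; apply: mulr_ge0.
  rewrite -w1; apply: ler_sum => i _.
  by rewrite ler_piMr//; case/andP: (q01 i).
have -> : \sum_i w i * y i = a + t * c.
  rewrite mulr_suml -[a in RHS]mul1r -w1 mulr_suml -big_split/=.
  by apply: eq_bigr => i _; rewrite yE mulrDr mulrA.
have -> : a + t * c + c ^+ 2 / 8 = a + (t * c + c ^+ 2 / 8) by rewrite addrA.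
rewrite expRD.
apply: (@le_trans _ _ (expR a * (1 - t + t * expR c))); last first.
  by rewrite ler_pM2l ?expR_gt0// hoeffding_bernoulli// ltW.
have -> : 1 - t + t * expR c = \sum_i w i * (1 - q i + q i * expR c).
  under [RHS]eq_bigr do rewrite mulrDr mulrBr mulr1 mulrA.
  by rewrite big_split sumrB/= w1 mulr_suml.
rewrite mulr_sumr; apply: ler_sum => i _.
by rewrite mulrCA ler_wpM2l// yE expR_chord.
Qed.

(** * Expectation over finite i.i.d. samples and McDiarmid's inequality *)

(** Integrating out one sample at a time makes conditioning on the first sample definitional. Since
    [F] accepts sequences of every length, fixing that sample leaves a function of the same type. *)
Fixpoint iid_expectation (R : realType) (I : finType) (w : I -> R) (m : nat)
    (F : seq I -> R) : R :=
  if m is m'.+1 then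
    \sum_i w i * iid_expectation w m' (fun s => F (i :: s))
  else F [::].

Lemma iid_expectationE (R : realType) (I : finType) (w : I -> R)
    m (F : seq I -> R) :
  iid_expectation w m F = \sum_(s : m.-tuple I) (\prod_(i <- s) w i) * F s.
Proof.
elim: m F => [|m IH] F /=.
  rewrite (big_pred1 [tuple]) ?big_nil ?mul1r// => s.
  by apply/esym/eqP; exact: (tuple0 s).
rewrite [RHS](reindex
  (fun x : I * m.-tuple I => cons_tuple x.1 x.2))/=; last first.
  exists (fun s : m.+1.-tuple I => (thead s, [tuple of behead s]))
    => [[i s]|s] _ /=.
    by congr (_, _); apply/val_inj.
  by rewrite [s in RHS]tuple_eta.
rewrite -(pair_bigA _ (fun i (s : m.-tuple I) =>
  (\prod_(j <- i :: s) w j) * F (i :: s)))/=.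
apply: eq_bigr => i _; rewrite IH mulr_sumr.
by apply: eq_bigr => s _; rewrite big_cons mulrA.
Qed.

Lemma iid_expectation_affine (R : realType) (I : finType) (w : I -> R)
    m (F : seq I -> R) (a b : R) :
  \sum_i w i = 1 ->
  iid_expectation w m (fun s => a * F s + b) = a * iid_expectation w m F + b.
Proof.
move=> w1; elim: m F => [//|m IH] F /=.
under eq_bigr do rewrite IH mulrDr mulrCA.
by rewrite big_split/= -mulr_sumr -mulr_suml w1 mul1r.
Qed.

Lemma le_iid_expectation (R : realType) (I : finType) (w : I -> R)
    m (F G : seq I -> R) :
  (forall i, 0 <= w i) -> (forall s, F s <= G s) ->
  iid_expectation w m F <= iid_expectation w m G.
Proof.
move=> w0; elim: m F G => [|m IH] F G FG /=; first exact: FG.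
by apply: ler_sum => i _; apply: ler_wpM2l => //; apply: IH => s; exact: FG.
Qed.

(* [F <= (F ^+ 2 / a + a) / 2] pointwise. *)
Lemma iid_expectation_le_sqr (R : realType) (I : finType) (w : I -> R)
    m (F : seq I -> R) (a : R) :
  (forall i, 0 <= w i) -> \sum_i w i = 1 -> 0 < a ->
  iid_expectation w m (fun s => F s ^+ 2) <= a ^+ 2 ->
  iid_expectation w m F <= a.
Proof.
move=> w0 w1 a0 Ea.
have FE s : F s <= (2 * a)^-1 * F s ^+ 2 + a / 2.
  have -> : (2 * a)^-1 * F s ^+ 2 + a / 2 = F s + (F s - a) ^+ 2 / (2 * a).
    by field; rewrite gt_eqF.
  by rewrite lerDl divr_ge0 ?sqr_ge0// mulr_ge0// ltW.
apply: (le_trans (le_iid_expectation m w0 FE)).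
rewrite iid_expectation_affine//.
apply: (@le_trans _ _ ((2 * a)^-1 * a ^+ 2 + a / 2)).
  by rewrite lerD2r ler_wpM2l// invr_ge0 mulr_ge0// ltW.
rewrite le_eqVlt; apply/orP; left; apply/eqP.
by field; rewrite gt_eqF.
Qed.

(** One-sided, since exchanging [i] and [j] gives the other sign. Ranging over all lengths, it
    passes to [fun s => F (i :: s)]. *)
Definition bounded_differences (R : realType) (I : Type) (F : seq I -> R)
    (c : R) :=
  forall s1 s2 i j, F (s1 ++ i :: s2) - F (s1 ++ j :: s2) <= c.

(** The martingale argument as an induction on [m]: the conditional mean [G i] given the first
    sample oscillates by at most [c], so Hoeffding's lemma costs a factor exp (c^2 / 8) per
    sample. *)
Lemma bounded_differences_mgf (R : realType) (I : finType) (w : I -> R)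
    m (F : seq I -> R) (c : R) :
  (forall i, 0 <= w i) -> \sum_i w i = 1 -> 0 < c -> bounded_differences F c ->
  iid_expectation w m (fun s => expR (F s)) <=
  expR (iid_expectation w m F + m%:R * (c ^+ 2 / 8)).
Proof.
move=> w0 w1 c0; elim: m F => [|m IH] F bF /=; first by rewrite mul0r addr0.
pose G i := iid_expectation w m (fun s => F (i :: s)).
have Gc i j : G i - G j <= c.
  rewrite lerBlDl -[G j]mul1r -iid_expectation_affine//.
  apply: le_iid_expectation => // s; rewrite mul1r -lerBlDl.
  exact: (bF [::]).
apply: (@le_trans _ _ (\sum_i w i * expR (G i) * expR (m%:R * (c ^+ 2 / 8)))).
  apply: ler_sum => i _; rewrite -mulrA ler_wpM2l// -expRD.
  by apply: IH => s1 s2 j k; exact: (bF (i :: s1)).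
rewrite -mulr_suml -[m.+1%:R]natr1 mulrDl mul1r [_ * _ + _]addrC addrA expRD.
by rewrite ler_wpM2r ?expR_ge0// hoeffding_lemma.
Qed.

(** Chernoff's method: the indicator is at most exp (k (F - mu - t)). Any upper bound [mu] on the
    mean will do, which suits a mean known only through its second moment. *)
Lemma mcdiarmid (R : realType) (I : finType) (w : I -> R)
    m (F : seq I -> R) (c mu t : R) :
  (forall i, 0 <= w i) -> \sum_i w i = 1 -> 0 < c -> bounded_differences F c ->
  (0 < m)%N -> 0 < t -> iid_expectation w m F <= mu ->
  iid_expectation w m (fun s => (mu + t < F s)%R%:R) <=
  expR (- (2 * t ^+ 2 / (m%:R * c ^+ 2))).
Proof.
move=> w0 w1 c0 bF m0 t0 EF.
have m0' : 0 < m%:R :> R by rewrite ltr0n.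
have mc0 : 0 < m%:R * c ^+ 2 by rewrite mulr_gt0// exprn_gt0.
(* The minimiser of - k t + m k^2 c^2 / 8. *)
pose k := 4 * t / (m%:R * c ^+ 2).
have k0 : 0 < k by rewrite divr_gt0// mulr_gt0.
pose H s := k * F s + - (k * (mu + t)).
have HE s : (mu + t < F s)%R%:R <= expR (H s).
  case: ltP => [lt_F|_]; last exact: expR_ge0.
  by rewrite -[leLHS]expR0 ler_expR /H -mulrBr mulr_ge0 ?subr_ge0// ltW.
have bH : bounded_differences H (k * c).
  move=> s1 s2 i j; rewrite /H opprD addrACA subrr addr0 -mulrBr.
  by rewrite ler_wpM2l// ltW.
apply: (le_trans (le_iid_expectation m w0 HE)).
apply: (le_trans (bounded_differences_mgf m w0 w1 (mulr_gt0 k0 c0) bH)).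
rewrite ler_expR iid_expectation_affine//.
apply: (@le_trans _ _ (k * mu - k * (mu + t) + m%:R * ((k * c) ^+ 2 / 8))).
  by rewrite !lerD2r ler_wpM2l// ltW.
rewrite le_eqVlt; apply/orP; left; apply/eqP.
by rewrite /k; field; rewrite !gt_eqF.
Qed.

(** * The Euclidean norm and its comparison with the p-norms *)

Definition norm2 (R : realType) (n : nat) (v : 'rV[R]_n) : R :=
  Num.sqrt (\sum_i v 0 i ^+ 2).

Lemma norm2_ge0 (R : realType) n (v : 'rV[R]_n) : 0 <= norm2 v.
Proof. exact: sqrtr_ge0. Qed.

Lemma sqr_norm2 (R : realType) n (v : 'rV[R]_n) :
  norm2 v ^+ 2 = \sum_i v 0 i ^+ 2.
Proof. by rewrite sqr_sqrtr// sumr_ge0// => i _; exact: sqr_ge0. Qed.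

Lemma norm2_eq0 (R : realType) n (v : 'rV[R]_n) : norm2 v = 0 -> v = 0.
Proof.
move=> v0; apply/rowP => i; rewrite mxE; apply/eqP; rewrite -sqrf_eq0.
have := sqr_norm2 v; rewrite v0 expr0n => /esym/eqP.
rewrite psumr_eq0 => [/allP/(_ i)|j _]; last exact: sqr_ge0.
by apply; rewrite mem_index_enum.
Qed.

Lemma norm2Z (R : realType) n (a : R) (v : 'rV[R]_n) :
  0 <= a -> norm2 (a *: v) = a * norm2 v.
Proof.
move=> a0; rewrite /norm2; under eq_bigr do rewrite mxE exprMn.
by rewrite -mulr_sumr sqrtrM ?sqr_ge0// sqrtr_sqr ger0_norm.
Qed.

Lemma cauchy_schwarz (R : realType) n (u v : 'rV[R]_n) :
  \sum_i u 0 i * v 0 i <= norm2 u * norm2 v.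
Proof.
have [/norm2_eq0 ->|u0] := eqVneq (norm2 u) 0.
  by rewrite big1 ?mulr_ge0 ?norm2_ge0// => i _; rewrite mxE mul0r.
have [/norm2_eq0 ->|v0] := eqVneq (norm2 v) 0.
  by rewrite big1 ?mulr_ge0 ?norm2_ge0// => i _; rewrite mxE mulr0.
have uv0 : 0 < norm2 u * norm2 v by rewrite mulr_gt0// lt0r ?u0 ?v0 norm2_ge0.
have : 0 <= \sum_i (norm2 v * u 0 i - norm2 u * v 0 i) ^+ 2.
  by apply: sumr_ge0 => i _; exact: sqr_ge0.
(* Expanding the square exposes the desired difference times a positive factor. *)
have -> : \sum_i (norm2 v * u 0 i - norm2 u * v 0 i) ^+ 2 =
    2 * (norm2 u * norm2 v) * (norm2 u * norm2 v - \sum_i u 0 i * v 0 i).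
  transitivity (norm2 v ^+ 2 * (\sum_i u 0 i ^+ 2) +
      norm2 u ^+ 2 * (\sum_i v 0 i ^+ 2) -
      2 * (norm2 u * norm2 v) * \sum_i u 0 i * v 0 i); last first.
    by rewrite -!sqr_norm2; ring.
  rewrite !mulr_sumr.
  rewrite -big_split -sumrB/=; apply: eq_bigr => i _; ring.
by rewrite pmulr_rge0 ?subr_ge0//; apply: mulr_gt0.
Qed.

Lemma sqr_norm2D (R : realType) n (u v : 'rV[R]_n) :
  norm2 (u + v) ^+ 2 =
  norm2 u ^+ 2 + norm2 v ^+ 2 + 2 * \sum_i u 0 i * v 0 i.
Proof.
rewrite !sqr_norm2 mulr_sumr -!big_split/=.
by apply: eq_bigr => i _; rewrite mxE; ring.
Qed.

Lemma norm2D (R : realType) n (u v : 'rV[R]_n) :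
  norm2 (u + v) <= norm2 u + norm2 v.
Proof.
rewrite -ler_sqr ?nnegrE ?addr_ge0 ?norm2_ge0// sqr_norm2D.
by have := cauchy_schwarz u v; lra.
Qed.

(** Each coordinate is at most [a] in absolute value, which settles p = +oo. For finite r, |v_i|^r =
    v_i^2 |v_i|^(r-2) <= v_i^2 a^(r-2), and these sum to at most a^r. *)
Lemma lpnorm_le (R : realType) (p : \bar R) n (v : 'rV[R]_n) (a : R) :
  (2%:E <= p)%E -> 0 < a -> norm2 v <= a -> lpnorm p v <= a.
Proof.
move=> p2 a0; rewrite -ler_sqr ?nnegrE ?norm2_ge0 ?(ltW a0)// sqr_norm2 => va.
have via i : `|v 0 i| <= a.
  rewrite -ler_sqr ?nnegrE ?normr_ge0 ?(ltW a0)// real_normK ?num_real//.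
  apply: le_trans va; rewrite (bigD1 i)//= lerDl sumr_ge0// => j _.
  exact: sqr_ge0.
case: p p2 => [r||] //=; last first.
  by move=> _; apply: bigmax_le => //; exact: ltW.
rewrite lee_fin => r2; have r0 : 0 < r by rewrite (lt_le_trans _ r2).
have powE (x : R) : 0 <= x -> x `^ r = x ^+ 2 * x `^ (r - 2).
  move=> x0; rewrite -powR_mulrn// -powRD ?subrKC//.
  by rewrite gt_eqF.
have -> : a = (a `^ r) `^ r^-1 by rewrite -powRrM mulfV ?gt_eqF// powRr1// ltW.
apply: ge0_ler_powR; rewrite ?nnegrE ?invr_ge0 ?(ltW r0) ?powR_ge0//.
  by apply: sumr_ge0 => i _; exact: powR_ge0.
rewrite powE ?(ltW a0)//.
apply: (@le_trans _ _ ((\sum_i v 0 i ^+ 2) * a `^ (r - 2))); last first.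
  by rewrite ler_wpM2r ?powR_ge0.
rewrite mulr_suml; apply: ler_sum => i _.
rewrite powE// real_normK ?num_real// ler_wpM2l ?sqr_ge0//.
by apply: ge0_ler_powR; rewrite ?nnegrE ?subr_ge0// ltW.
Qed.

(** * Mean and tail of the deviation of the counts *)

Definition sample_deviation (R : realType) (n : nat) (A : 'rV[R]_n)
    (s : seq 'I_n) : 'rV[R]_n :=
  \sum_(i <- s) (delta_mx 0 i - A).

Lemma sample_deviationE (R : realType) m n (A : 'rV[R]_n) (s : m.-tuple 'I_n) :
  (0 < m)%N ->
  empirical R (tnth s) - A = m%:R^-1 *: sample_deviation A s.
Proof.
move=> m0; have m0' : m%:R != 0 :> R by rewrite pnatr_eq0 -lt0n.
apply/rowP => k; rewrite !mxE summxE big_tuple.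
under eq_bigr do rewrite !mxE eqxx /=.
rewrite sumrB sumr_const card_ord -[A 0 k *+ m]mulr_natl mulrBr mulKf//.
congr (_ - _).
rewrite mulrC; congr (_ * _); rewrite -sum1_card natr_sum.
under [in LHS]eq_bigl do rewrite inE.
by rewrite big_mkcond/=; apply: eq_bigr => j _; rewrite eq_sym; case: eqP.
Qed.

Lemma norm2_sample_deviation_bounded (R : realType) n (A : 'rV[R]_n) :
  bounded_differences (fun s => norm2 (sample_deviation A s)) (Num.sqrt 2).
Proof.
move=> s1 s2 i j; rewrite lerBlDl.
set u := sample_deviation _ _; set v := sample_deviation _ _.
have -> : u = v + (delta_mx 0 i - delta_mx 0 j).
  rewrite /u /v /sample_deviation !big_cat !big_cons/=.
  by apply/rowP => k; rewrite !mxE; ring.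
apply: (le_trans (norm2D _ _)); rewrite lerD2l ler_wsqrtr//.
(* Coordinatewise, the square of e_i - e_j is at most e_i + e_j, whose entries sum to 2; this
   includes the case i = j. *)
have -> : 2 = \sum_k ((k == i)%:R + (k == j)%:R) :> R.
  have E l : \sum_k (k == l)%:R = 1 :> R.
    by rewrite (bigD1 l)//= eqxx big1 ?addr0// => k /negPf ->.
  by rewrite big_split/= !E.
apply: ler_sum => k _; rewrite !mxE eqxx/=.
by case: (k == i); case: (k == j); rewrite /=; lra.
Qed.

(** The summands e_(X_j) - A are independent and centred, so their second moments add; each is 1 -
    |A|^2 <= 1. *)
Lemma expectation_sqr_sample_deviation (R : realType) m n (A : 'rV[R]_n) :
  is_distribution A ->
  iid_expectation (A 0) m (fun s => norm2 (sample_deviation A s) ^+ 2) <= m%:R.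
Proof.
move=> [A0 A1].
(* An arbitrary starting vector [v] lets the induction absorb the first sample. *)
suff H (v : 'rV[R]_n) : iid_expectation (A 0) m
    (fun s => norm2 (v + sample_deviation A s) ^+ 2) <= norm2 v ^+ 2 + m%:R.
  have := H 0; rewrite sqr_norm2 [in leRHS]big1 ?add0r => [|i _]; last first.
    by rewrite mxE expr0n.
  by under eq_fun do rewrite add0r.
elim: m v => [|m IH] v /=.
  by rewrite /sample_deviation big_nil !addr0.
have stepE i : norm2 (v + (delta_mx 0 i - A)) ^+ 2 =
    2 * (v 0 i - A 0 i) + (norm2 (v - A) ^+ 2 + 1).
  rewrite [delta_mx 0 i - A]addrC addrA (sqr_norm2D (v - A)).
  rewrite (sqr_norm2 (delta_mx _ _)).
  rewrite (bigD1 i)//= big1 => [|k /negPf ki]; last by rewrite mxE ki expr0n.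
  rewrite [in X in 2 * X](bigD1 i)//=.
  rewrite [in X in 2 * (_ + X)]big1 => [|k /negPf ki].
    by rewrite !mxE !eqxx/=; ring.
  by rewrite [delta_mx _ _ _ _]mxE ki mulr0.
apply: (@le_trans _ _ (\sum_i A 0 i *
    (norm2 (v + (delta_mx 0 i - A)) ^+ 2 + m%:R))).
  apply: ler_sum => i _; rewrite ler_wpM2l//; apply: le_trans (IH _).
  by under eq_fun do rewrite /sample_deviation big_cons addrA.
have -> : \sum_i A 0 i * (norm2 (v + (delta_mx 0 i - A)) ^+ 2 + m%:R) =
    2 * (\sum_i v 0 i * A 0 i - norm2 A ^+ 2) + (norm2 (v - A) ^+ 2 + 1 + m%:R).
  set K := (X in _ = _ + X).
  have -> : K = \sum_i A 0 i * K by rewrite -mulr_suml A1 mul1r.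
  rewrite [norm2 A ^+ 2]sqr_norm2 -sumrB mulr_sumr -big_split/=.
  by apply: eq_bigr => i _; rewrite stepE /K; ring.
have -> : norm2 (v - A) ^+ 2 =
    norm2 v ^+ 2 + norm2 A ^+ 2 - 2 * \sum_i v 0 i * A 0 i.
  rewrite sqr_norm2D; congr (_ + _ + _).
    by rewrite !sqr_norm2; apply: eq_bigr => i _; rewrite mxE sqrrN.
  rewrite -mulrN -sumrN; congr (_ * _).
  by apply: eq_bigr => i _; rewrite mxE mulrN.
(* The inner products cancel, leaving |v|^2 + 1 - |A|^2 + m. *)
by rewrite -[m.+1%:R]natr1; have := sqr_ge0 (norm2 A); lra.
Qed.

Lemma sample_deviation_tail (R : realType) m n (A : 'rV[R]_n) (eps delta : R) :
  is_distribution A -> 0 < eps -> 0 < delta -> delta <= 1 / expR 1 ->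
  4 * ln (1 / delta) / eps ^+ 2 <= m%:R ->
  (0 < m)%N /\
  iid_expectation (A 0) m
    (fun s => (m%:R * eps < norm2 (sample_deviation A s))%R%:R) <= delta.
Proof.
move=> dA eps0 delta0 delta1; set L := ln (1 / delta) => hm.
have [A0 A1] := dA.
have L1 : 1 <= L.
  rewrite -[1 in leLHS]expRK /L ler_ln ?posrE ?expR_gt0 ?divr_gt0//.
  by rewrite ler_pdivlMr// mulrC -ler_pdivlMr ?expR_gt0.
have deltaE : delta = expR (- L).
  by rewrite /L expRN lnK ?posrE ?divr_gt0// div1r invrK.
have m0 : (0 < m)%N.
  rewrite -(ltr0n R); apply: lt_le_trans hm.
  by rewrite divr_gt0 ?exprn_gt0// mulr_gt0// (lt_le_trans _ L1).
split=> //.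
have m0' : 0 < m%:R :> R by rewrite ltr0n.
pose r := Num.sqrt (m%:R : R); pose l := Num.sqrt L.
have r0 : 0 < r by rewrite sqrtr_gt0.
have rE : r ^+ 2 = m%:R by rewrite sqr_sqrtr// ltW.
have lE : l ^+ 2 = L by rewrite sqr_sqrtr// (le_trans _ L1).
have l1 : 1 <= l by rewrite -[1]sqrtr1 ler_wsqrtr.
(* The square root of the sample size condition m >= 4 L / eps^2. *)
have rl : 2 * l <= r * eps.
  rewrite -ler_sqr ?nnegrE ?mulr_ge0 ?(ltW r0) ?(ltW eps0)//; last first.
    exact: le_trans l1.
  rewrite !exprMn rE lE -ler_pdivrMr ?exprn_gt0//.
  by apply: le_trans hm; rewrite expr2 -natrM.
pose t := m%:R * eps - r.
have tE : t = r * (r * eps - 1) by rewrite /t -rE; ring.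
have t0 : 0 < t by rewrite tE mulr_gt0//; lra.
have mu : iid_expectation (A 0) m (fun s => norm2 (sample_deviation A s)) <= r.
  apply: iid_expectation_le_sqr; rewrite ?rE//.
  exact: expectation_sqr_sample_deviation.
have c0 : 0 < Num.sqrt 2 :> R by rewrite sqrtr_gt0.
have := mcdiarmid A0 A1 c0 (norm2_sample_deviation_bounded A) m0 t0 mu.
rewrite /t subrKC sqr_sqrtr// => /le_trans; apply.
rewrite deltaE ler_expR lerN2 -lE -/t.
(* McDiarmid's exponent with c^2 = 2. It remains to see r eps - 1 >= 2 l - 1 >= l, which uses l >=
   1. *)
have -> : 2 * t ^+ 2 / (m%:R * 2) = (r * eps - 1) ^+ 2.
  by rewrite tE -rE; field; rewrite gt_eqF.
by rewrite ler_sqr ?nnegrE; lra.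
Qed.

(** * From the probability space to sums over sample tuples *)

(** Indexing the intersection by the full set matches the form in which independence is stated. *)
Lemma sample_fiberE (T : Type) m (I : eqType) (X : 'I_m -> T -> I)
    (t : m.-tuple I) :
  [set w | [tuple X j w | j < m] = t] =
  \bigcap_(j in [set` [set: 'I_m]%SET]) X j @^-1` [set tnth t j].
Proof.
apply/seteqP; split => w /=.
  by move=> <- j _ /=; rewrite tnth_mktuple.
by move=> Xt; apply: eq_from_tnth => j; rewrite tnth_mktuple Xt//= inE.
Qed.

Lemma sample_preimageE (T : Type) m (I : finType) (X : 'I_m -> T -> I)
    (H : pred (m.-tuple I)) :
  [set w | H [tuple X j w | j < m]] =
  \big[setU/set0]_(t | H t) [set w | [tuple X j w | j < m] = t].
Proof.
rewrite -bigcup_pred; apply/seteqP; split => w /=.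
  by move=> Hw; exists [tuple X j w | j < m].
by move=> [t /= Ht ->].
Qed.

Section IidSamples.
Variables (d : measure_display) (T : measurableType d) (R : realType).
Variables (P : probability T R) (m n : nat) (A : 'rV[R]_n).
Variables (X : 'I_m -> T -> 'I_n) (hX : iid_samples P A X).

Lemma measurable_sample_fiber (t : m.-tuple 'I_n) :
  measurable [set w | [tuple X j w | j < m] = t].
Proof.
by have [Xm _ _] := hX; rewrite sample_fiberE; exact: fin_bigcap_measurable.
Qed.

Lemma measurable_sample_preimage (H : pred (m.-tuple 'I_n)) :
  measurable [set w | H [tuple X j w | j < m]].
Proof.
rewrite sample_preimageE; apply: bigsetU_measurable => t _.
exact: measurable_sample_fiber.
Qed.

Lemma probability_sample_fiber (t : m.-tuple 'I_n) :
  P [set w | [tuple X j w | j < m] = t] = (\prod_(i <- t) A 0 i)%:E.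
Proof.
have [_ XA indX] := hX.
rewrite sample_fiberE indX big_tuple (big_morph _ (@EFinM R) erefl).
by apply: eq_big => [j|j _]; [rewrite inE|exact: XA].
Qed.

(** A union bound over the finitely many outcomes satisfying [H], each of probability the product of
    its weights. *)
Lemma probability_sample_le (H : pred (seq 'I_n)) :
  (P [set w | H [tuple X j w | j < m]] <=
   (iid_expectation (A 0) m (fun s => (H s)%:R))%:E)%E.
Proof.
rewrite (sample_preimageE X (fun t => H t)).
(* Measurability is carried through the induction because subadditivity asks for it at each
   union. *)
suff [] : measurable (\big[setU/set0]_(t : m.-tuple 'I_n | H t)
      [set w | [tuple X j w | j < m] = t]) /\
    (P (\big[setU/set0]_(t : m.-tuple 'I_n | H t)
       [set w | [tuple X j w | j < m] = t]) <=
     \sum_(t : m.-tuple 'I_n | H t) (\prod_(i <- t) A 0 i)%:E)%E.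
  move=> _ /le_trans; apply.
  rewrite iid_expectationE sumEFin lee_fin big_mkcond/=.
  by apply: ler_sum => t _; case: ifP; rewrite ?mulr1 ?mulr0.
apply: (big_ind2 (fun S x => measurable S /\ (P S <= x)%E)).
- by rewrite measure0.
- move=> S x S' x' [mS Sx] [mS' Sx']; split; first exact: measurableU.
  by apply: (le_trans (measureU2 _ mS mS')); exact: leeD.
- move=> t _; split; last by rewrite probability_sample_fiber.
  exact: measurable_sample_fiber.
Qed.

End IidSamples.

Theorem theorem16 (R : realType) (p : \bar R) (hp : (2%:E <= p)%E)
  (n : nat) (hn : (2 <= n)%N)
  (eps : R) (heps0 : 0 < eps) (heps1 : eps < 1)
  (delta : R) (hdelta0 : 0 < delta) (hdelta1 : delta <= 1 / expR 1)
  (A : 'rV[R]_n) (hA : is_distribution A)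
  (m : nat) (hm : 4 * ln (1 / delta) / eps ^+ 2 <= m%:R)
  (d : measure_display) (T : measurableType d) (P : probability T R)
  (X : 'I_m -> T -> 'I_n) (hX : iid_samples P A X) :
  ((1 - delta)%:E <=
     P [set w | (lpnorm p (empirical R (fun j => X j w) - A) <= eps)%R])%E.
Proof.
have [m0 tail] := sample_deviation_tail hA heps0 hdelta0 hdelta1 hm.
pose bad s := m%:R * eps < norm2 (sample_deviation A s).
pose good (t : m.-tuple 'I_n) := lpnorm p (empirical R (tnth t) - A) <= eps.
have -> : [set w | lpnorm p (empirical R (fun j => X j w) - A) <= eps] =
    [set w | good [tuple X j w | j < m]].
  rewrite /good; apply: eq_set => w.
  congr (is_true (lpnorm p (empirical R _ - A) <= eps)).
  by apply/funext => j; rewrite tnth_mktuple.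
pose B := [set w | bad [tuple X j w | j < m]].
have mB : measurable B.
  exact: (measurable_sample_preimage hX (fun t => bad t)).
have PB : (P B <= delta%:E)%E.
  by apply: le_trans (probability_sample_le hX bad) _; rewrite lee_fin.
(* It suffices that the complement of the bad event lies in the good one: there the Euclidean norm
   of the error, |D| / m, is at most eps. *)
apply: (@le_trans _ _ (P (~` B))).
  by rewrite probability_setC// EFinB leeB.
apply: le_measure; rewrite ?inE.
- exact: measurableC.
- exact: (measurable_sample_preimage hX good).
move=> w /negP; rewrite /bad -leNgt => dev.
have m0' : 0 < m%:R :> R by rewrite ltr0n.
apply: lpnorm_le => //; rewrite sample_deviationE// norm2Z ?invr_ge0//.
by rewrite ler_pdivrMl.
Qed.
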